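(* Let $K$ be a number field, let $S$ be a finite set of primes of $K$ containing all archimedean ones, and let $\mathcal O=\mathcal O_S$ be the ring of $S$-integers of $K$. For $k\ge 2$ let $\mathcal V_k\subset\mathbb A^k_{/\mathcal O}$ be the affine variety defined by $x_1x_2\cdots x_k=1$. Then for every $k\geq 2$ the set $\mathcal V_k(\mathcal O)$ of $\mathcal O$-points is Zariski dense in $\mathcal V_k$ if and only if the group of units $\mathcal O^\times$ is infinite.
   Context: The ring of $S$-integers is $\mathcal O_S=\{x\in K\mid v(x)\ge 0\text{ for all primes } v\notin S\}$. Zariski density: for an affine variety $V\subseteq\mathbb A^k_{/\mathcal O}$, the $\mathcal O$-points $V(\mathcal O)\subseteq\mathcal O^k$ are Zariski dense if every polynomial in $K[x_1,\ldots,x_k]$ vanishing on $V(\mathcal O)$ vanishes on $V(\overline K)$. *)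

(* Defs.v *)
From HB Require Import structures.
From mathcomp Require Import all_boot all_order all_algebra all_field.
(* The notations of mpoly clash with those of MathComp-Analysis. *)
From mathcomp Require Import -(notations) mpoly.
From mathcomp Require Import all_classical all_reals all_analysis.

Set Implicit Arguments.
Unset Strict Implicit.
Unset Printing Implicit Defensive.

Import Order.TTheory GRing.Theory Num.Theory.
Local Open Scope classical_set_scope.
Local Open Scope ring_scope.

(* The primes (places) of a number field, archimedean or not, are the
   equivalence classes of its nontrivial absolute values.  The type R only
   serves as the real line in which absolute values take their values. *)
Record absolute_value (R : realType) (K : fieldType) := AbsoluteValue {
  absv :> K -> R;
  absv_ge0 : forall x, 0 <= absv x;
  absv_eq0 : forall x, absv x = 0 <-> x = 0;
  absvM : forall x y, absv (x * y) = absv x * absv y;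
  absv_triangle : forall x y, absv (x + y) <= absv x + absv y;
  absv_nontrivial : exists2 x, x != 0 & absv x != 1 }.

Definition absv_equiv (R : realType) (K : fieldType)
    (v w : absolute_value R K) : Prop :=
  exists2 s : R, 0 < s & forall x, w x = v x `^ s.

Definition ultrametric (R : realType) (K : fieldType)
    (v : absolute_value R K) : Prop :=
  forall x y, v (x + y) <= Num.max (v x) (v y).

Record place (R : realType) (K : fieldType) := Place {
  place_class :> set (absolute_value R K);
  place_classP : exists v, place_class = [set w | absv_equiv v w] }.

Definition archimedean_place (R : realType) (K : fieldType)
    (p : place R K) : Prop :=
  exists2 v, place_class p v & ~ ultrametric v.

(* The additive valuation x |-> - log |x|, with value +oo at 0. *)
Definition valuation (R : realType) (K : fieldType)
    (v : absolute_value R K) (x : K) : \bar R :=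
  (- lne (v x)%:E)%E.

(* Equivalent absolute values have proportional valuations, so the sign of
   the valuation depends only on the place. *)
Definition S_integers (R : realType) (K : fieldType)
    (S : set (place R K)) : set K :=
  [set x | forall p : place R K, ~ S p ->
     forall v, place_class p v -> (0 <= valuation v x)%E].

Definition units_of (K : fieldType) (A : set K) : set K :=
  [set u | A u /\ exists2 w, A w & u * w = 1].

Definition is_algebraic_closure (K : fieldType) (L : closedFieldType)
    (iota : {rmorphism K -> L}) : Prop :=
  forall z : L, algebraicOver iota z.

(* An affine variety in k-space is given by a list F of equations. *)
Definition zero_locus (k : nat) (K : fieldType)
    (F : seq (mpoly k K)) : set ('I_k -> K) :=
  [set x | forall f, f \in F -> meval x f = 0].

Definition points_in (k : nat) (K : fieldType) (A : set K)
    (F : seq (mpoly k K)) : set ('I_k -> K) :=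
  zero_locus F `&` [set x | forall i, A (x i)].

Definition points_dense (k : nat) (K : fieldType) (L : closedFieldType)
    (iota : {rmorphism K -> L}) (A : set K)
    (F : seq (mpoly k K)) : Prop :=
  forall g : mpoly k K,
    (forall x, points_in A F x -> meval x g = 0) ->
    forall y, zero_locus [seq map_mpoly iota f | f <- F] y ->
      meval y (map_mpoly iota g) = 0.

(* mpolyX (mnm1 i) is the i-th variable. *)
Definition product_one_variety (k : nat) (K : fieldType) :
    seq (mpoly k K) :=
  [:: (\prod_(i < k) mpolyX K (mnm1 i)) - 1].

(* Main.v *)
(** A point of [prod x_i = 1] over the multiplicatively closed set [O] is a
    tuple of units of [O].  If there are finitely many units [u], then
    [prod_u (x_0 - u)] vanishes at all of these tuples, but not at
    [(t, 1/t, 1, .., 1)] for a suitable [t] in the algebraic closure.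
    Conversely, if there are infinitely many units and [g] vanishes at all
    tuples of units with product 1, then the coordinates can be freed one at a
    time: with the other coordinates fixed, and the last one adjusted to keep
    the product equal to 1, [g] becomes a Laurent polynomial in the freed
    coordinate, which vanishes at infinitely many points. *)
Require Import Defs.
From mathcomp Require Import all_boot all_order all_algebra all_field.
From mathcomp Require Import -(notations) mpoly.
From mathcomp Require Import all_classical all_reals all_analysis.

Set Implicit Arguments.
Unset Strict Implicit.
Unset Printing Implicit Defensive.

Import Order.TTheory GRing.Theory Num.Theory.
Local Open Scope classical_set_scope.
Local Open Scope ring_scope.

(** Transfers vanishing at a point over [K] to vanishing at its image over an extension. *)
Lemma meval_map_mpoly (n : nat) (K L : comNzRingType)
    (f : {rmorphism K -> L}) (x : 'I_n -> K) (g : mpoly n K) :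
  meval (f \o x) (map_mpoly f g) = f (meval x g).
Proof.
rewrite [in RHS]mevalE [LHS]raddf_sum [RHS]raddf_sum /=; apply: eq_bigr => m _.
rewrite !rmorphM /= mevalC mmap1_id mevalX rmorph_prod.
by congr (_ * _); apply: eq_bigr => i _; rewrite rmorphXn.
Qed.

Section Laurent.
Variable L : fieldType.

(** Away from 0, [f] is the Laurent polynomial [p / t ^+ N]. Nothing is asked at [t = 0], so the
    convention for [c / 0] does not matter. *)
Definition laurent (f : L -> L) : Prop :=
  exists (p : {poly L}) (N : nat), forall t, t != 0 -> t ^+ N * f t = p.[t].

Lemma laurent_cst c : laurent (fun=> c).
Proof. by exists c%:P, 0%N => t _; rewrite expr0 mul1r hornerC. Qed.

Lemma laurent_id : laurent id.
Proof. by exists 'X, 0%N => t _; rewrite expr0 mul1r hornerX. Qed.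

Lemma laurent_divl c : laurent (fun t => c / t).
Proof. by exists c%:P, 1%N => t t0; rewrite expr1 hornerC mulrCA divff ?mulr1. Qed.

Lemma laurentD f g : laurent f -> laurent g -> laurent (fun t => f t + g t).
Proof.
move=> [p [N Hp]] [q [M Hq]]; exists ('X^M * p + 'X^N * q), (N + M)%N => t t0.
rewrite hornerD !hornerM !hornerXn -Hp // -Hq // mulrDr exprD !mulrA.
by rewrite (mulrC (t ^+ M)).
Qed.

Lemma laurentM f g : laurent f -> laurent g -> laurent (fun t => f t * g t).
Proof.
move=> [p [N Hp]] [q [M Hq]]; exists (p * q), (N + M)%N => t t0.
by rewrite hornerM -Hp // -Hq // exprD mulrACA.
Qed.

(** The expansion of [g] into monomials reduces this to closure under sums and products. *)
Lemma laurent_meval (n : nat) (y : L -> 'I_n -> L) (g : mpoly n L) :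
  (forall i, laurent (fun t => y t i)) -> laurent (fun t => meval (y t) g).
Proof.
move=> Hy.
suff H : laurent (fun t =>
    \sum_(m <- msupp g) mcoeff m g * \prod_(i < n) y t i ^+ m i).
  case: H => p [N Hp]; exists p, N => t t0; rewrite mevalE; exact: Hp.
elim: (msupp g) => [|m s IHs].
  by under eq_fun do rewrite big_nil; exact: laurent_cst.
under eq_fun do rewrite big_cons.
apply: laurentD IHs; apply: laurentM; first exact: laurent_cst.
elim: (index_enum _) => [|i r IHr].
  by under eq_fun do rewrite big_nil; exact: laurent_cst.
under eq_fun do rewrite big_cons.
apply: laurentM IHr; elim: (m i) => [|e IHe].
  by under eq_fun do rewrite expr0; exact: laurent_cst.
by under eq_fun do rewrite exprS; exact: laurentM.
Qed.

(** The numerator [p] vanishes on all of [A], so it has more roots than its degree allows and is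
    zero. *)
Lemma laurent_eq0 (f : L -> L) (A : set L) : laurent f -> infinite_set A ->
  (forall t, A t -> t != 0 /\ f t = 0) -> forall t, t != 0 -> f t = 0.
Proof.
move=> [p [N Hp]] infA HA t t0.
have p0 : p = 0.
  have [B BA sB] := infinite_set_fset (size p) infA.
  apply: roots_geq_poly_eq0 sB; last exact: finmap.fset_uniq.
  apply/allP => u uB; have [u0 fu] := HA u (BA u uB).
  by rewrite /root -Hp // fu mulr0.
move: (Hp t t0); rewrite p0 horner0 => /eqP.
by rewrite mulf_eq0 expf_eq0 (negbTE t0) andbF => /eqP.
Qed.

End Laurent.

Section UnitsOf.
Variables (K : fieldType) (A : set K).
Hypotheses (A1 : A 1) (AM : forall x y, A x -> A y -> A (x * y)).

Lemma units_of1 : units_of A 1.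
Proof. by split=> //; exists 1; rewrite ?mulr1. Qed.

Lemma units_ofM u v : units_of A u -> units_of A v -> units_of A (u * v).
Proof.
move=> [Au [u' Au' uu']] [Av [v' Av' vv']]; split; first exact: AM.
by exists (u' * v'); [exact: AM | rewrite mulrACA uu' vv' mulr1].
Qed.

Lemma units_of_neq0 u : units_of A u -> u != 0.
Proof.
by move=> [_ [w _ +]]; apply: contra_eq_neq => ->; rewrite mul0r eq_sym oner_neq0.
Qed.

Lemma units_ofV u : units_of A u -> units_of A u^-1.
Proof.
move=> Uu; have u0 := units_of_neq0 Uu; case: Uu => Au [w Aw uw].
have -> : u^-1 = w by rewrite -[w](mulKf u0) uw mulr1.
by split=> //; exists u => //; rewrite mulrC.
Qed.

Lemma units_of_prod (I : Type) (r : seq I) (P : pred I) (F : I -> K) :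
  (forall i, P i -> units_of A (F i)) -> units_of A (\prod_(i <- r | P i) F i).
Proof. by apply: big_ind; [exact: units_of1 | exact: units_ofM]. Qed.

Lemma zero_locus_product_one (n : nat) (x : 'I_n -> K) :
  zero_locus (product_one_variety n K) x <-> \prod_i x i = 1.
Proof.
have E : meval x (\prod_(i < n) mpolyX K (mnm1 i) - 1) = \prod_i x i - 1.
  rewrite mevalB meval1 rmorph_prod; congr (_ - _).
  by apply: eq_bigr => i _; rewrite /= mevalXU.
split=> [/(_ _ (mem_head _ _)) | x1 f]; first by rewrite E => /subr0_eq.
by rewrite inE => /eqP ->; rewrite E x1 subrr.
Qed.

(** The inverse of each coordinate is the product of the others, which lies in [A] again. *)
Lemma product_one_points (n : nat) (x : 'I_n -> K) :
  points_in A (product_one_variety n K) x <->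
  \prod_i x i = 1 /\ forall i, units_of A (x i).
Proof.
split=> [[/zero_locus_product_one x1 Ax] | [x1 Ux]]; split=> //.
- move=> i; split; first exact: Ax.
  exists (\prod_(j < n | j != i) x j); last by rewrite -[RHS]x1 [RHS](bigD1 i).
  by apply: (big_ind A) => // j _; exact: Ax.
- exact/zero_locus_product_one.
- by move=> i; case: (Ux i).
Qed.

End UnitsOf.

Lemma map_product_one_variety (k : nat) (K L : fieldType)
    (f : {rmorphism K -> L}) :
  [seq map_mpoly f g | g <- product_one_variety k K] = product_one_variety k L.
Proof.
rewrite /= rmorphB rmorph1 rmorph_prod /=; congr [:: _ - _].
by apply: eq_bigr => i _; rewrite map_mpolyX.
Qed.

Lemma product_one_dense (k : nat) (K : fieldType) (L : closedFieldType)
    (iota : {rmorphism K -> L}) (A : set K) :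
  A 1 -> (forall x y, A x -> A y -> A (x * y)) -> infinite_set (units_of A) ->
  points_dense iota A (product_one_variety k.+1 K).
Proof.
move=> A1 AM infU g Hg y; rewrite map_product_one_variety.
move=> /zero_locus_product_one.
set U := units_of A in infU; set G := map_mpoly iota g.
(* The first [j] coordinates of [y] are free. *)
suff H j (z : 'I_k.+1 -> L) : \prod_i z i = 1 ->
    (forall i : 'I_k.+1, (j <= i < k)%N -> exists2 u, U u & z i = iota u) ->
    meval z G = 0.
  by move=> y1; apply: (H k) => // i; rewrite ltnNge andbN.
elim: j z => [|j IHj] z z1 Uz.
  (* With no free coordinate, [z] comes from a point over [A]. The value of [x] at [ord_max] is a
     dummy; [x'] puts there the inverse of the product of the other coordinates, as the equation
     forces. *)
  have /choice[x Hx] (i : 'I_k.+1) :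
      exists u, i != ord_max -> U u /\ z i = iota u.
    case: (eqVneq i ord_max) => [->|ik]; first by exists 0.
    have [|u Uu zu] := Uz i; last by exists u.
    by rewrite /= ltn_neqAle -ltnS ltn_ord andbT -val_eqE in ik *.
  pose c := \prod_(i < k.+1 | i != ord_max) x i.
  have Uc : U c by apply: units_of_prod => // i /Hx[].
  have c0 : c != 0 := units_of_neq0 Uc.
  pose x' i := if i == ord_max then c^-1 else x i.
  have x'1 : \prod_i x' i = 1.
    rewrite (bigD1 ord_max) //= {1}/x' eqxx.
    rewrite (eq_bigr x) => [|i /negbTE ik]; last by rewrite /x' ik.
    exact: mulVf.
  have zE : z =1 iota \o x'.
    move=> i /=; rewrite /x'; case: eqVneq => [-> | ik]; last by case: (Hx i ik).
    have ic0 : iota c != 0 by rewrite fmorph_eq0.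
    apply: (mulfI ic0); rewrite -rmorphM divff // rmorph1 -[RHS]z1.
    rewrite [RHS](bigD1 ord_max) //= mulrC rmorph_prod; congr (_ * _).
    by apply: eq_bigr => j /Hx[].
  rewrite (meval_eq _ zE) meval_map_mpoly Hg ?rmorph0 //.
  apply/product_one_points => //; split=> // i; rewrite /x'.
  by case: eqVneq => [_ | /Hx[]//]; apply: units_ofV.
(* If [k <= j], the unit conditions for [j] and [j.+1] are both vacuous. Otherwise coordinate [j] is
   the one to be freed. *)
have [jk|kj] := ltnP j k; last first.
  by apply: IHj => // i /andP[ji ik]; move: (leq_ltn_trans ji ik); rewrite ltnNge kj.
pose i0 : 'I_k.+1 := Ordinal (ltnW jk : j < k.+1)%N.
have i0k : ord_max != i0 :> 'I_k.+1 by rewrite -val_eqE /= gtn_eqF.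
(* Replacing these two coordinates by [t] and [c / t] preserves their product, and [t = z i0] gives
   back [z]. *)
pose c := z i0 * z ord_max.
pose w t i := if i == i0 then t else if i == ord_max then c / t else z i.
have zi0 : z i0 != 0.
  by apply/eqP => zi; move/eqP: z1; rewrite (bigD1 i0) //= zi mul0r eq_sym oner_eq0.
have zw : z =1 w (z i0).
  move=> i; rewrite /w; case: eqVneq => [-> // | _]; case: eqVneq => [-> | //].
  by rewrite /c mulrAC divff // mul1r.
have w1 t : t != 0 -> \prod_i w t i = 1.
  move=> t0; rewrite -[RHS]z1 !(bigD1 i0 isT) /= !(bigD1 ord_max i0k) /= !mulrA.
  congr (_ * _); first by rewrite /w eqxx (negbTE i0k) eqxx mulrCA divff ?mulr1.
  by apply: eq_bigr => i /andP[/negbTE ni /negbTE nk]; rewrite /w ni nk.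
rewrite (meval_eq _ zw).
(* The test values of [t] are the images of units, infinitely many because [iota] is injective. At
   such a [t] coordinate [j] is a unit too, so the induction hypothesis applies. *)
apply: (@laurent_eq0 _ (fun t => meval (w t) G) (iota @` U)) => //.
- apply: laurent_meval => i; rewrite /w.
  case: eqP => _; first exact: laurent_id.
  by case: eqP => _; [exact: laurent_divl | exact: laurent_cst].
- move=> finV; apply: infU; apply: sub_finite_set (@preimage_image _ _ iota U) _.
  by apply: finite_preimage finV => u v _ _; exact: fmorph_inj.
move=> _ [u Uu <-]; have u0 : iota u != 0.
  by rewrite fmorph_eq0; exact: units_of_neq0 Uu.
split=> //; apply: IHj; first exact: w1.
move=> i /andP[ji ik]; rewrite /w; case: eqVneq => [_|ni]; first by exists u.
case: eqVneq => [ie|_]; first by rewrite ie ltnn in ik.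
by apply: Uz; rewrite ik andbT ltn_neqAle ji andbT eq_sym -val_eqE in ni *.
Qed.

Lemma product_one_not_dense (k : nat) (K : fieldType) (L : closedFieldType)
    (iota : {rmorphism K -> L}) (A : set K) :
  A 1 -> (forall x y, A x -> A y -> A (x * y)) -> finite_set (units_of A) ->
  ~ points_dense iota A (product_one_variety k.+2 K).
Proof.
move=> A1 AM /finite_seqP[s Us] dense.
(* With at least two coordinates, the first and the last are distinct and can carry [t] and
   [t^-1]. *)
pose i0 : 'I_k.+2 := ord0; pose i1 : 'I_k.+2 := ord_max.
pose g : mpoly k.+2 K := \prod_(u <- s) (mpolyX K (mnm1 i0) - mpolyC _ u).
have Hg x : points_in A (product_one_variety k.+2 K) x -> meval x g = 0.
  move=> /(product_one_points A1 AM)[_ /(_ i0)]; rewrite Us /= => xs.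
  rewrite rmorph_prod /= (big_rem _ xs) /= mevalB mevalXU mevalC subrr.
  by rewrite mul0r.
(* A non-root of [q] is nonzero, thanks to the factor ['X], and differs from the image of every
   unit. *)
pose q : {poly L} := 'X * \prod_(u <- s) ('X - (iota u)%:P).
have /closed_nonrootP[t] : q != 0.
  rewrite mulf_neq0 ?polyX_eq0 //; apply: monic_neq0.
  exact: monic_prod_XsubC.
rewrite /root hornerM hornerX mulf_eq0 negb_or => /andP[t0 /negP]; apply.
pose y i := if i == i0 then t else if i == i1 then t^-1 else 1.
have Hy : zero_locus (product_one_variety k.+2 L) y.
  apply/zero_locus_product_one.
  rewrite (bigD1 i0) //= (bigD1 i1) //= big1 => [|i /andP[/negbTE ni /negbTE nk]].
    by rewrite /y /= eqxx mulr1 divff.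
  by rewrite /y ni nk.
rewrite -(map_product_one_variety _ iota) in Hy.
(* Density makes [g] vanish at [y], where its value is the second factor of [q] at [t]; this
   contradicts the choice of [t]. *)
rewrite -(dense g Hg y Hy) !rmorph_prod horner_prod; apply/eqP/eq_bigr => u _.
rewrite /= hornerXsubC rmorphB /= map_mpolyX map_mpolyC mevalB mevalXU mevalC.
by rewrite /y eqxx.
Qed.

(** Passes to the multiplicative form, in which closure under products is immediate. The case
    [x = 0] is covered, with valuation [+oo]. *)
Lemma valuation_ge0 (R : realType) (K : fieldType) (v : absolute_value R K)
    (x : K) : (0 <= valuation v x)%E = (v x <= 1).
Proof. by rewrite /valuation oppe_ge0 lne_le0 lee_fin. Qed.

Lemma absv1 (R : realType) (K : fieldType) (v : absolute_value R K) : v 1 = 1.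
Proof.
have v0 : v 1 != 0 by apply/eqP => /absv_eq0/eqP; rewrite oner_eq0.
by apply: (mulfI v0); rewrite -absvM !mulr1.
Qed.

Lemma S_integers1 (R : realType) (K : fieldType) (S : set (place R K)) :
  S_integers S 1.
Proof. by move=> p _ v _; rewrite valuation_ge0 absv1. Qed.

Lemma S_integersM (R : realType) (K : fieldType) (S : set (place R K)) x y :
  S_integers S x -> S_integers S y -> S_integers S (x * y).
Proof.
move=> Sx Sy p Sp v pv; move: (Sx p Sp v pv) (Sy p Sp v pv).
rewrite !valuation_ge0 absvM => vx vy.
by apply: mulr_ile1 => //; exact: absv_ge0.
Qed.

Theorem theorem1p1 (R : realType) (K : fieldExtType rat)
    (Kbar : closedFieldType) (iota : {rmorphism K -> Kbar})
    (hKbar : is_algebraic_closure iota)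
    (S : set (place R K)) (finS : finite_set S)
    (archS : forall p : place R K, archimedean_place p -> S p)
    (k : nat) (hk : (2 <= k)%N) :
  points_dense iota (S_integers S) (product_one_variety k K) <->
  infinite_set (units_of (S_integers S)).
Proof.
have O1 := @S_integers1 R K S; have OM := @S_integersM R K S.
case: k hk => [|[|k]] // _; split=> [dense finU | infU].
  exact: product_one_not_dense dense.
exact: product_one_dense.
Qed.
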